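(* Let $(\mathfrak g,R)$ be a Rota-Baxter Lie algebra of weight $\lambda\in\mathbf k$ in characteristic $p>0$, and let $(\mathrm U_{\mathrm{RB}}(\mathfrak g),R)$ be the universal enveloping Rota-Baxter associative algebra of $(\mathfrak g,R)$. Then $(\mathrm U_{\mathrm{RB}}(\mathfrak g)^-,(-)^p,R)$, where $\mathrm U_{\mathrm{RB}}(\mathfrak g)^-$ is the commutator Lie algebra and $(-)^p$ the $p$-th power map, is a restricted Rota-Baxter Lie algebra of weight $\lambda$.
   Context: Convention: $\mathbf k$ is an algebraically closed field of prime characteristic $p$; everything is over $\mathbf k$. A Rota-Baxter (associative) algebra of weight $\lambda$ is an associative algebra $A$ with a linear map $P:A\to A$ such that $P(x)P(y)=P(P(x)y)+P(xP(y))+\lambda P(xy)$. A Rota-Baxter Lie algebra of weight $\lambda$ is a Lie algebra with a linear map $R$ such that $[R(x),R(y)]=R([R(x),y])+R([x,R(y)])+\lambda R([x,y])$. For a Rota-Baxter algebra $(A,P)$, $(A^-,P)$ with $A^-$ the commutator Lie algebra is a Rota-Baxter Lie algebra of the same weight. The universal enveloping Rota-Baxter associative algebra $(\mathrm U_{\mathrm{RB}}(\mathfrak g),R)$ of $(\mathfrak g,R)$ is a Rota-Baxter algebra of weight $\lambda$ with a Rota-Baxter Lie algebra homomorphism $\mathfrak g\to\mathrm U_{\mathrm{RB}}(\mathfrak g)^-$ that is universal among Rota-Baxter Lie algebra homomorphisms from $\mathfrak g$ to $A^-$ with $(A,P)$ a Rota-Baxter algebra of weight $\lambda$ (i.e.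 the left adjoint of $(A,P)\mapsto(A^-,P)$). Restricted Lie algebra: a Lie algebra $(\mathfrak g,[-,-])$ with a $p$-map $(-)^{[p]}:\mathfrak g\to\mathfrak g$ satisfying $(ax)^{[p]}=a^px^{[p]}$ for $a\in\mathbf k$, $[x^{[p]},y]=(\mathrm{ad}_x)^p(y)$, and $(x+y)^{[p]}=x^{[p]}+y^{[p]}+\sum_{i=1}^{p-1}s_i(x,y)$, where $i\,s_i(x,y)$ is the coefficient of $t^{i-1}$ in $(\mathrm{ad}_{tx+y})^{p-1}(x)\in\mathbf k[t]\otimes\mathfrak g$. For a composition $\alpha=(\alpha_1,\dots,\alpha_r)\vDash n$ (a tuple of positive integers with sum $n$, of length $\ell(\alpha)=r$), $C_\alpha=\prod_{k=1}^r\binom{\alpha_1+\cdots+\alpha_k-1}{\alpha_k-1}$. A restricted Rota-Baxter Lie algebra $(\mathfrak g,[-,-],(-)^{[p]},R)$ of weight $\lambda$ is a restricted Lie algebra with a Rota-Baxter operator $R$ of weight $\lambda$ such that $R(x^{[p]_R})=R(x)^{[p]}$ for all $x$, where, with $x\rhd_Ry:=[R(x),y]$ and $x^{\rhd_Rk}:=x\rhd_R(x\rhd_R\cdots(x\rhd_Rx)\cdots)$ ($k$ copies of $x$, $x^{\rhd_R1}=x$), $$x^{[p]_R}:=\lambda^{p-1}x^{[p]}+\sum_{r=1}^{p-1}\frac1r\lambda^{r-1}\sum_{\alpha\vDash p,\ \ell(\alpha)=r}C_\alpha\,[x^{\rhd_R\alpha_1},[x^{\rhd_R\alpha_2},[\cdots[x^{\rhd_R\alpha_{r-1}},x^{\rhd_R\alpha_r}]\cdots]]]$$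 ($\lambda^0=1$; $\frac1r$ is the inverse of $r$ modulo $p$). *)

(* Defs.v *)
From mathcomp Require Import all_boot all_order all_algebra.

Set Implicit Arguments.
Unset Strict Implicit.
Unset Printing Implicit Defensive.

Import GRing.Theory.
Local Open Scope ring_scope.

(* MathComp algebras ([algType]) carry a nontrivial unit and MathComp has no
   Lie algebras, so both kinds of algebra are given here by a binary operation
   on a vector space. *)

Definition bilinear_op (k : fieldType) (V : lmodType k) (op : V -> V -> V) :
    Prop :=
  (forall y, linear (op^~ y)) /\ (forall x, linear (op x)).

Record is_assoc_algebra (k : fieldType) (A : lmodType k) (mul : A -> A -> A) :
    Prop := IsAssocAlgebra {
  assoc_algebra_bilinear : bilinear_op mul;
  assoc_algebra_assoc : associative mul
}.

Record is_lie_algebra (k : fieldType) (L : lmodType k) (br : L -> L -> L) :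
    Prop := IsLieAlgebra {
  lie_algebra_bilinear : bilinear_op br;
  lie_algebra_alternating : forall x, br x x = 0;
  lie_algebra_jacobi :
    forall x y z, br x (br y z) + br y (br z x) + br z (br x y) = 0
}.

Definition is_rb_operator (k : fieldType) (lam : k) (V : lmodType k)
    (op : V -> V -> V) (P : V -> V) : Prop :=
  linear P /\
  forall x y, op (P x) (P y) =
    P (op (P x) y) + P (op x (P y)) + lam *: P (op x y).

Definition is_rb_algebra (k : fieldType) (lam : k) (A : lmodType k)
    (mul : A -> A -> A) (P : A -> A) : Prop :=
  is_assoc_algebra mul /\ is_rb_operator lam mul P.

Definition is_rb_lie_algebra (k : fieldType) (lam : k) (L : lmodType k)
    (br : L -> L -> L) (R : L -> L) : Prop :=
  is_lie_algebra br /\ is_rb_operator lam br R.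

(* Homomorphisms of Rota-Baxter algebras, associative or Lie. *)
Definition is_rb_hom (k : fieldType) (V W : lmodType k)
    (opV : V -> V -> V) (P : V -> V) (opW : W -> W -> W) (Q : W -> W)
    (f : V -> W) : Prop :=
  [/\ linear f,
      forall x y, f (opV x y) = opW (f x) (f y) &
      forall x, f (P x) = Q (f x)].

Definition commutator_bracket (k : fieldType) (A : lmodType k)
    (mul : A -> A -> A) : A -> A -> A :=
  fun x y => mul x y - mul y x.

(* [x ^ n] for [n >= 1]; the junk value at [n = 0] is [x]. *)
Definition assoc_pow (k : fieldType) (A : lmodType k) (mul : A -> A -> A)
    (n : nat) (x : A) : A :=
  iter n.-1 (mul x) x.

Definition is_two_sided_unit (k : fieldType) (A : lmodType k)
    (mul : A -> A -> A) (e : A) : Prop :=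
  left_id e mul /\ right_id e mul.

(* The universal property of the universal enveloping Rota-Baxter associative
   algebra. The flag chooses the category of Rota-Baxter algebras: if [unital]
   is true, associative algebras have a unit and their homomorphisms preserve
   it; if it is false, no unit is mentioned. *)

Definition in_algebra_category (unital : bool) (k : fieldType)
    (A : lmodType k) (mul : A -> A -> A) : Prop :=
  unital -> exists e, is_two_sided_unit mul e.

Definition in_hom_category (unital : bool) (k : fieldType) (A B : lmodType k)
    (mulA : A -> A -> A) (mulB : B -> B -> B) (f : A -> B) : Prop :=
  unital -> forall e, is_two_sided_unit mulA e -> is_two_sided_unit mulB (f e).

Record is_universal_enveloping_rb_algebra (unital : bool) (k : fieldType)
    (lam : k) (g : lmodType k) (br : g -> g -> g) (R : g -> g)
    (U : lmodType k) (mul : U -> U -> U) (P : U -> U) (iota : g -> U) :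
    Prop := IsUniversalEnvelopingRBAlgebra {
  universal_enveloping_rb : is_rb_algebra lam mul P;
  universal_enveloping_cat : in_algebra_category unital mul;
  universal_enveloping_hom : is_rb_hom br R (commutator_bracket mul) P iota;
  universal_enveloping_universal :
    forall (A : lmodType k) (mulA : A -> A -> A) (PA : A -> A),
      is_rb_algebra lam mulA PA -> in_algebra_category unital mulA ->
    forall f : g -> A, is_rb_hom br R (commutator_bracket mulA) PA f ->
    let extends (F : U -> A) :=
      [/\ is_rb_hom mul P mulA PA F, in_hom_category unital mul mulA F &
          forall x, F (iota x) = f x] in
    exists2 F : U -> A, extends F & forall F' : U -> A, extends F' -> F' =1 F
}.

(* An element of [k[t] (x) L] is represented by its sequence of coefficients;
   this is the action of [ad_(t x + y)]. *)
Definition ad_txy (k : fieldType) (L : lmodType k) (br : L -> L -> L)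
    (x y : L) (c : nat -> L) : nat -> L :=
  fun n => (if n is m.+1 then br x (c m) else 0) + br y (c n).

(* [i * s_i(x, y)] is the coefficient of [t^(i-1)] in
   [(ad_(t x + y))^(p-1) (x)]. *)
Definition jacobson_s (p : nat) (k : fieldType) (L : lmodType k)
    (br : L -> L -> L) (i : nat) (x y : L) : L :=
  (i%:R : k)^-1 *:
    iter p.-1 (ad_txy br x y) (fun n => if n == 0%N then x else 0) i.-1.

Record is_restricted_lie_algebra (p : nat) (k : fieldType) (L : lmodType k)
    (br : L -> L -> L) (pmap : L -> L) : Prop := IsRestrictedLieAlgebra {
  restricted_lie : is_lie_algebra br;
  restricted_scale : forall (a : k) x, pmap (a *: x) = a ^+ p *: pmap x;
  restricted_ad : forall x y, br (pmap x) y = iter p (br x) y;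
  restricted_add : forall x y,
    pmap (x + y) = pmap x + pmap y + \sum_(1 <= i < p) jacobson_s p br i x y
}.

(* [C_alpha], with [k] shifted to start at 0. *)
Definition composition_coef (alpha : seq nat) : nat :=
  \prod_(k < size alpha)
    'C(sumn (take k.+1 alpha) - 1, nth 0%N alpha k - 1).

(* [x |> (x |> ... (x |> x))], with [n >= 1] copies of [x]. *)
Definition rb_left_power (k : fieldType) (L : lmodType k) (br : L -> L -> L)
    (R : L -> L) (x : L) (n : nat) : L :=
  iter n.-1 (br (R x)) x.

(* [[x_1, [x_2, ... [x_(r-1), x_r]]]]; the value on the empty sequence is
   junk. *)
Fixpoint right_nested_bracket (k : fieldType) (L : lmodType k)
    (br : L -> L -> L) (s : seq L) : L :=
  match s with
  | [::] => 0
  | [:: x] => x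
  | x :: s' => br x (right_nested_bracket br s')
  end.

(* [x^([p]_R)]. Compositions of [p] of length [r] are the [r]-tuples of
   positive integers with sum [p]; their entries are at most [p]. *)
Definition rb_pmap (p : nat) (k : fieldType) (lam : k) (L : lmodType k)
    (br : L -> L -> L) (pmap : L -> L) (R : L -> L) (x : L) : L :=
  lam ^+ p.-1 *: pmap x +
  \sum_(1 <= r < p) ((r%:R : k)^-1 * lam ^+ r.-1) *:
    \sum_(t : r.-tuple 'I_p.+1 |
          let alpha := map val t in
          all (fun a => 0 < a)%N alpha && (sumn alpha == p))
      let alpha := map val t in
      right_nested_bracket br (map (rb_left_power br R x) alpha)
        *+ composition_coef alpha.

Record is_restricted_rb_lie_algebra (p : nat) (k : fieldType) (lam : k)
    (L : lmodType k) (br : L -> L -> L) (pmap : L -> L) (R : L -> L) : Prop :=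
  IsRestrictedRBLieAlgebra {
  restricted_rb_restricted : is_restricted_lie_algebra p br pmap;
  restricted_rb_operator : is_rb_operator lam br R;
  restricted_rb_pmap : forall x, R (rb_pmap p lam br pmap R x) = pmap (R x)
}.

(* Main.v *)
(* For a Rota-Baxter algebra (A, P) put x * y = P(x) y + x P(y) + lam x y, so
   that P is multiplicative from (A, * ) to A. It therefore suffices that the
   p-th *-power of x is x^([p]_R). With a = P(x), the former is
     sum_j (a + lam x)^(p-1-j) x a^j = sum_r lam^(r-1) W_r,
   where W_r is the sum of the words with r letters x and p - r letters a.
   Jacobson's formula says that r W_r is the sum of the words in ad x and ad a
   with r - 1 letters ad x and p - r letters ad a, applied to x; moving every
   ad a to the right past the ad x by the Leibniz rule turns it into the sum
   over the compositions of p of length r. The computation takes place in the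
   unitization of A. *)

Require Import Defs.
From HB Require Import structures.
From mathcomp Require Import all_boot all_order all_algebra.

Set Implicit Arguments.
Unset Strict Implicit.
Unset Printing Implicit Defensive.
Import GRing.Theory.
Local Open Scope ring_scope.

(** * Unitization *)

Definition unitization (k : fieldType) (A : lmodType k) (mul : A -> A -> A)
  (h : is_assoc_algebra mul) : Type := (k^o * A)%type.

Section Unitization.

Variables (k : fieldType) (A : lmodType k) (mul : A -> A -> A).
Hypothesis h : is_assoc_algebra mul.
Local Notation B := (unitization h).

Let mulDlA x y z : mul (x + y) z = mul x z + mul y z.
Proof. by have := (assoc_algebra_bilinear h).1 z 1 x y; rewrite !scale1r. Qed.

Let mulDrA x y z : mul x (y + z) = mul x y + mul x z.
Proof. by have := (assoc_algebra_bilinear h).2 x 1 y z; rewrite !scale1r. Qed.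

Let mul0A z : mul 0 z = 0.
Proof. by apply: (addrI (mul 0 z)); rewrite -mulDlA !addr0. Qed.

Let mulA0 z : mul z 0 = 0.
Proof. by apply: (addrI (mul z 0)); rewrite -mulDrA !addr0. Qed.

Let mulZlA a x z : mul (a *: x) z = a *: mul x z.
Proof.
by have := (assoc_algebra_bilinear h).1 z a x 0; rewrite !addr0 mul0A addr0.
Qed.

Let mulZrA a x z : mul z (a *: x) = a *: mul z x.
Proof.
by have := (assoc_algebra_bilinear h).2 z a x 0; rewrite !addr0 mulA0 addr0.
Qed.

HB.instance Definition _ := GRing.Lmodule.copy B (k^o * A)%type.

Definition unitization_mul (u v : B) : B :=
  (u.1 * v.1, u.1 *: v.2 + v.1 *: u.2 + mul u.2 v.2).

Lemma unitization_mulA : associative unitization_mul.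
Proof.
move=> [a x] [b y] [c z]; rewrite /unitization_mul /=; congr pair.
  by rewrite mulrA.
rewrite !mulDlA !mulDrA !mulZlA !mulZrA !scalerDr !scalerA.
rewrite (assoc_algebra_assoc h) (mulrC c a) (mulrC c b) -!addrA; congr (_ + _).
congr (_ + _); rewrite addrCA; congr (_ + _).
by rewrite [RHS]addrCA; congr (_ + _); exact: addrCA.
Qed.

Lemma unitization_mul1 : left_id ((1, 0) : B) unitization_mul.
Proof.
by case=> a x; rewrite /unitization_mul /= mul1r scale1r scaler0 mul0A !addr0.
Qed.

Lemma unitization_1mul : right_id ((1, 0) : B) unitization_mul.
Proof.
case=> a x.
by rewrite /unitization_mul /= mulr1 scale1r scaler0 mulA0 addr0 add0r.
Qed.

Lemma unitization_mulDl : left_distributive unitization_mul +%R.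
Proof.
move=> [a x] [b y] [c z]; rewrite /unitization_mul /=; congr pair.
  by rewrite /= mulrDl.
rewrite /= mulDlA scalerDl scalerDr (addrACA _ (mul x z)); congr (_ + _).
by rewrite addrACA.
Qed.

Lemma unitization_mulDr : right_distributive unitization_mul +%R.
Proof.
move=> [a x] [b y] [c z]; rewrite /unitization_mul /=; congr pair.
  by rewrite /= mulrDr.
rewrite /= mulDrA scalerDl scalerDr (addrACA _ (mul x y)); congr (_ + _).
by rewrite addrACA.
Qed.

Lemma unitization_1neq0 : ((1, 0) : B) != 0.
Proof. by apply/eqP => -[/eqP]; rewrite oner_eq0. Qed.

HB.instance Definition _ := GRing.Zmodule_isNzRing.Build B unitization_mulA
  unitization_mul1 unitization_1mul unitization_mulDl unitization_mulDr
  unitization_1neq0.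

Lemma unitization_scaleAl (a : k) (u v : B) : a *: (u * v) = (a *: u) * v.
Proof.
case: u v => [b x] [c y]; congr pair; rewrite /=; first exact: mulrA.
by rewrite !scalerDr mulZlA !scalerA (mulrC c).
Qed.

HB.instance Definition _ :=
  GRing.Lmodule_isLalgebra.Build k B unitization_scaleAl.

Lemma unitization_scaleAr (a : k) (u v : B) : a *: (u * v) = u * (a *: v).
Proof.
case: u v => [b x] [c y]; congr pair; rewrite /=; first exact: mulrCA.
by rewrite !scalerDr mulZrA !scalerA (mulrC b).
Qed.

HB.instance Definition _ :=
  GRing.Lalgebra_isAlgebra.Build k B unitization_scaleAr.

Definition unitization_in (x : A) : B := (0, x).

Fact unitization_in_linear : linear unitization_in.
Proof. by move=> a x y; congr pair; rewrite /= scaler0 addr0. Qed.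

HB.instance Definition _ :=
  GRing.isLinear.Build k A B *:%R unitization_in unitization_in_linear.

Lemma unitization_in_inj : injective unitization_in.
Proof. by move=> x y []. Qed.

Lemma unitization_inM x y :
  unitization_in (mul x y) = unitization_in x * unitization_in y.
Proof. by congr pair; rewrite /= ?mul0r // !scale0r !add0r. Qed.

End Unitization.

(** * Sums over compositions *)

Definition composition_sum (V : nmodType) (p r n : nat) (F : seq nat -> V) :
    V :=
  \sum_(t : r.-tuple 'I_p.+1 |
        all (fun a => 0 < a)%N (map val t) && (sumn (map val t) == n))
    F (map val t).

Lemma big_tuple_rcons (V : nmodType) (T : finType) r (P : pred (seq T))
    (F : seq T -> V) :
  \sum_(t : r.+1.-tuple T | P t) F t =
  \sum_(x : T) \sum_(t : r.-tuple T | P (rcons t x)) F (rcons t x).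
Proof.
rewrite pair_big_dep /=.
pose f (q : T * r.-tuple T) := [tuple of rcons q.2 q.1].
have fI : injective f.
  by move=> [x s] [y t] /(congr1 val) /rcons_inj [/val_inj -> ->].
rewrite (reindex f) //=; apply: onW_bij; apply: inj_card_bij => //.
by rewrite card_prod !card_tuple expnS.
Qed.

Lemma sum_composition_rcons (V : nmodType) (p r n : nat) (F : seq nat -> V) :
  (n < p)%N ->
  composition_sum p r.+1 n.+1 F =
  \sum_(j < n.+1) composition_sum p r (n - j) (fun s => F (rcons s j.+1)).
Proof.
move=> ltnp; rewrite /composition_sum.
rewrite (big_tuple_rcons r
  (fun s : seq 'I_p.+1 =>
    all (fun a => 0 < a)%N (map val s) && (sumn (map val s) == n.+1))
  (fun s : seq 'I_p.+1 => F (map val s))) big_ord_recl /=.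
rewrite big_pred0 ?add0r => [|t]; last by rewrite map_rcons all_rcons.
rewrite (big_ord_widen p (fun j => \sum_(t : r.-tuple 'I_p.+1 |
  all (fun a => 0 < a)%N (map val t) && (sumn (map val t) == n - j)%N)
    F (rcons (map val t) j.+1))) // [RHS]big_mkcond /=.
apply: eq_bigr => j _; case: ltnP => [ltjn | lenj].
  apply: eq_big => [t | t _]; last by rewrite map_rcons.
  rewrite map_rcons all_rcons sumn_rcons /= /bump /= add1n addnS eqSS.
  by rewrite -[in LHS](subnK (ltnSE ltjn)) eqn_add2r.
apply: big_pred0 => t.
rewrite map_rcons all_rcons sumn_rcons /= /bump /= add1n addnS eqSS.
by rewrite gtn_eqF ?andbF // ltn_addl.
Qed.

Lemma sum_composition0 (V : nmodType) (p n : nat) (F : seq nat -> V) :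
  composition_sum p 0 n F = if n == 0%N then F [::] else 0.
Proof.
rewrite /composition_sum; case: eqP => [-> | /eqP n0].
  by rewrite (big_pred1 [tuple]) // => t; rewrite !tuple0; symmetry; apply/eqP.
by apply: big_pred0 => t; rewrite tuple0 /= eq_sym (negPf n0).
Qed.

Lemma sum_composition_S0 (V : nmodType) (p r : nat) (F : seq nat -> V) :
  composition_sum p r.+1 0 F = 0.
Proof.
apply: big_pred0 => t; case/tupleP: t => x t /=.
by case: (nat_of_ord x) => //= m; rewrite addSn andbF.
Qed.

Lemma composition_coef_rcons s m :
  composition_coef (rcons s m) =
  (composition_coef s * 'C(sumn s + m - 1, m - 1))%N.
Proof.
rewrite /composition_coef size_rcons big_ord_recr /=; congr (_ * _)%N.
  apply: eq_bigr => i _; rewrite -cats1 takel_cat // nth_cat ltn_ord //.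
by rewrite take_oversize ?size_rcons // sumn_rcons nth_rcons ltnn eqxx.
Qed.

Lemma right_nested_bracket_rcons (k : fieldType) (L : lmodType k)
    (br : L -> L -> L) s y :
  right_nested_bracket br (rcons s y) = foldr br y s.
Proof. by elim: s => //= x s <-; case: s. Qed.

(** * Words in inner derivations *)

Lemma big_pascal (V : nmodType) n (F : nat -> V) :
  \sum_(j < n.+1) F j *+ 'C(n, j) + \sum_(j < n.+1) F j.+1 *+ 'C(n, j) =
  \sum_(j < n.+2) F j *+ 'C(n.+1, j).
Proof.
rewrite [RHS]big_ord_recl /= bin0.
under [in RHS]eq_bigr => i _ do rewrite /bump /= add1n binS mulrnDr.
rewrite big_split /= addrA; congr (_ + _).
by rewrite [in RHS]big_ord_recr /= bin_small // mulr0n addr0 big_ord_recl bin0.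
Qed.

Section AdWords.

Variables (k : fieldType) (B : algType k) (a x : B).
Local Notation br := (commutator_bracket (A := B) *%R).

Lemma bracketD (z : B) : {morph br z : u v / u + v}.
Proof.
by move=> u v; rewrite /commutator_bracket mulrDl mulrDr opprD addrACA.
Qed.

Lemma bracket0 (z : B) : br z 0 = 0.
Proof. by rewrite /commutator_bracket mulr0 mul0r subrr. Qed.

Lemma bracket_sumMn (z : B) I (s : seq I) (P : pred I) F c :
  br z (\sum_(i <- s | P i) F i *+ c i) = \sum_(i <- s | P i) br z (F i) *+ c i.
Proof.
rewrite (big_morph _ (bracketD z) (bracket0 z)); apply: eq_bigr => i _.
by rewrite /commutator_bracket mulrnAr mulrnAl mulrnBl.
Qed.

Lemma bracket_bracket (u v w : B) :
  br u (br v w) = br (br u v) w + br v (br u w).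
Proof.
rewrite /commutator_bracket !mulrBr !mulrBl !mulrA !opprB !addrA.
rewrite [RHS](ACl (1*8*6*3*(2*5)*(4*7))) /= !addNr !addr0.
by rewrite addrAC.
Qed.

Lemma bracketC (u v : B) : br u v = - br v u.
Proof. by rewrite /commutator_bracket opprB. Qed.

Lemma bracket_jacobi (u v w : B) :
  br u (br v w) + br v (br w u) + br w (br u v) = 0.
Proof.
rewrite bracket_bracket (bracketC w (br u v)) addrAC.
rewrite [_ + br v (br u w)]addrC addrK (bracketC w u).
by rewrite -bracketD subrr bracket0.
Qed.

(* The sum of the words with [r] letters [ad x] and [n - r] letters [ad a],
   applied to [y]. *)
Definition ad_words (n r : nat) (y : B) : B :=
  iter n (ad_txy br x a) (fun i => if i == 0%N then y else 0) r.

Lemma ad_wordsS n r y :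
  ad_words n.+1 r y =
  (if r is r'.+1 then br x (ad_words n r' y) else 0) + br a (ad_words n r y).
Proof. by []. Qed.

(* The sum of [C_alpha (ad x_(alpha_1)) ... (ad x_(alpha_r)) y] over the
   compositions [alpha] of [n] of length [r], where [x_i = (ad a)^(i-1) x]; the
   recursion splits off the last part. *)
Fixpoint block_sum (r n : nat) (y : B) : B :=
  match r, n with
  | 0, 0 => y
  | 0, _.+1 => 0
  | _.+1, 0 => 0
  | r'.+1, n'.+1 =>
    \sum_(j < n'.+1) block_sum r' (n' - j) (br (iter j (br a) x) y) *+ 'C(n', j)
  end.

Lemma block_sumD r n : {morph block_sum r n : u v / u + v}.
Proof.
elim: r n => [|r IH] [|n] u v //=; rewrite ?addr0 // -big_split /=.
by apply: eq_bigr => j _; rewrite bracketD IH mulrnDl.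
Qed.

Lemma bracket_block_sum r n y :
  br a (block_sum r n y) + (if r is r'.+1 then br x (block_sum r' n y) else 0) =
  block_sum r n (br a y) + block_sum r n.+1 y.
Proof.
elim: r n y => [|r IH] [|n] y.
- by rewrite /= !addr0.
- by rewrite /= !addr0 bracket0.
- rewrite /= big_ord_recl big_ord0 /= addr0 add0r subn0 bin0.
  by rewrite bracket0 add0r; case: r {IH} => [|r] //=; rewrite bracket0.
have E : br x (block_sum r n.+1 y) =
   \sum_(j < n.+1) (if r is r'.+1 then
    br x (block_sum r' (n - j) (br (iter j (br a) x) y)) else 0) *+ 'C(n, j).
  case: r {IH} => [|r].
    by rewrite /= bracket0 big1 // => *; rewrite mul0rn.
  exact: bracket_sumMn.
rewrite E [block_sum r.+1 n.+1 y]/= bracket_sumMn -big_split /=.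
under eq_bigr => j _ do rewrite -mulrnDl IH bracket_bracket block_sumD
  [_ + block_sum r (n - j) (br _ (br a y))]addrC -addrA mulrnDl.
rewrite big_split /=; congr (_ + _).
rewrite -(big_pascal n
  (fun j => block_sum r (n.+1 - j) (br (iter j (br a) x) y))).
rewrite [RHS]addrC -big_split /=; apply: eq_bigr => j _.
by rewrite subSS -mulrnDl subSn // -ltnS.
Qed.

Lemma ad_wordsE n r y :
  ad_words n r y =
  \sum_(j < n.+1) block_sum r (n - j) (iter j (br a) y) *+ 'C(n, j).
Proof.
elim: n r y => [|n IH] r y.
  by rewrite big_ord_recl big_ord0 /= addr0; case: r.
rewrite -(big_pascal n (fun j => block_sum r (n.+1 - j) (iter j (br a) y))).
rewrite -big_split.
rewrite ad_wordsS IH bracket_sumMn addrC.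
have -> : (if r is r'.+1 then br x (ad_words n r' y) else 0) =
  \sum_(j < n.+1) (if r is r'.+1 then
    br x (block_sum r' (n - j) (iter j (br a) y)) else 0) *+ 'C(n, j).
  case: r => [|r]; first by rewrite big1 // => *; rewrite mul0rn.
  by rewrite IH bracket_sumMn.
rewrite -big_split /=; apply: eq_bigr => j _.
by rewrite -!mulrnDl bracket_block_sum subSS subSn 1?addrC // -ltnS.
Qed.

Lemma composition_block_sum p r n y : (n <= p)%N ->
  composition_sum p r n (fun s =>
    foldr br y (map (rb_left_power br (fun=> a) x) s) *+ composition_coef s) =
  block_sum r n y.
Proof.
elim: r n y => [|r IH] n y lenp.
  by rewrite sum_composition0 /composition_coef big_ord0 /=; case: n {lenp}.
case: n lenp => [|n] ltnp; first exact: sum_composition_S0.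
rewrite sum_composition_rcons //=; apply: eq_bigr => j _.
rewrite -IH; last by rewrite (leq_trans (leq_subr _ _)) // ltnW.
rewrite -sumrMnl; apply: eq_bigr => t /andP[_ /eqP st].
rewrite map_rcons foldr_rcons composition_coef_rcons mulrnA.
congr (_ *+ 'C(_, _)).
  by rewrite st addnS subn1 /= subnK // -ltnS.
by rewrite subn1.
Qed.

Lemma composition_ad_words p r : (0 < p)%N ->
  composition_sum p r.+1 p (fun s =>
    right_nested_bracket br (map (rb_left_power br (fun=> a) x) s)
      *+ composition_coef s) = ad_words p.-1 r x.
Proof.
case: p => // n _; rewrite sum_composition_rcons // ad_wordsE /=.
apply: eq_bigr => j _.
rewrite -(@composition_block_sum n.+1); last exact: leq_trans (leq_subr _ _) _.
rewrite -sumrMnl; apply: eq_bigr => t /andP[_ /eqP st].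
rewrite map_rcons right_nested_bracket_rcons composition_coef_rcons mulrnA.
congr (_ *+ 'C(_, _)).
  by rewrite st addnS subn1 /= subnK // -ltnS.
by rewrite subn1.
Qed.

End AdWords.

(** * Commutators and powers in characteristic p *)

Section CharacteristicP.

Variables (S : nzRingType) (p : nat).
Hypothesis charSp : p \in [pchar S].

Lemma signr_bin_pred_pchar i : (i < p)%N -> (-1) ^+ i *+ 'C(p.-1, i) = 1 :> S.
Proof.
have p_pr := pcharf_prime charSp.
elim: i => [|i IH] ltip; first by rewrite bin0 expr0.
have := prime_dvd_bin p_pr (ltip : 0 < i.+1 < p)%N.
rewrite (dvdn_pcharf charSp) -[X in 'C(X, _)](prednK (prime_gt0 p_pr)) binS.
rewrite natrD addr_eq0 => /eqP E.
by rewrite exprS mulN1r -mulr_natr E mulrNN mulr_natr IH // ltnW.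
Qed.

Lemma iter_commutatorE n (c y : S) :
  iter n (fun u => c * u - u * c) y =
  \sum_(j < n.+1) (-1) ^+ j * c ^+ (n - j) * y * c ^+ j *+ 'C(n, j).
Proof.
elim: n => [|n IH].
  by rewrite big_ord_recl big_ord0 /= !expr0 bin0 !mul1r mulr1 addr0.
rewrite iterS IH mulr_sumr mulr_suml -sumrN.
rewrite -(big_pascal n (fun j => (-1) ^+ j * c ^+ (n.+1 - j) * y * c ^+ j)).
congr (_ + _); apply: eq_bigr => j _.
  rewrite mulrnAr !mulrA commr_sign -[_ * c * _]mulrA -exprS subSn //.
  exact: ltnSE.
by rewrite mulrnAl -mulNrn subSS [c ^+ j.+1]exprSr !mulrA exprS mulN1r !mulNr.
Qed.

Lemma iter_commutator_pred_pchar (c y : S) :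
  iter p.-1 (fun u => c * u - u * c) y =
  \sum_(j < p) c ^+ (p.-1 - j) * y * c ^+ j.
Proof.
rewrite iter_commutatorE prednK ?prime_gt0 ?(pcharf_prime charSp) //.
apply: eq_bigr => j _; rewrite -!mulrA -mulrnAl signr_bin_pred_pchar //.
by rewrite mul1r.
Qed.

Lemma iter_commutator_pchar (c y : S) :
  iter p (fun u => c * u - u * c) y = c ^+ p * y - y * c ^+ p.
Proof.
have p_gt0 := prime_gt0 (pcharf_prime charSp).
rewrite -[in LHS](prednK p_gt0) iterS iter_commutator_pred_pchar.
pose G j := c ^+ (p - j) * y * c ^+ j.
rewrite mulr_sumr mulr_suml.
have -> : \sum_(j < p) c * (c ^+ (p.-1 - j) * y * c ^+ j) = \sum_(j < p) G j.
  apply: eq_bigr => j _; rewrite /G !mulrA -exprS -subSn ?prednK //.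
  by rewrite -ltnS prednK.
have -> : \sum_(j < p) c ^+ (p.-1 - j) * y * c ^+ j * c = \sum_(j < p) G j.+1.
  apply: eq_bigr => j _.
  by rewrite /G -!mulrA -exprSr -subn1 subnAC subn1 -subnS.
have : \sum_(j < p.+1) G j = \sum_(j < p.+1) G j by [].
rewrite {1}big_ord_recl big_ord_recr /= /G subn0 subnn !expr0 mul1r mulr1.
move=> E; apply/eqP; rewrite subr_eq addrAC eq_sym subr_eq; apply/eqP.
by rewrite E addrC.
Qed.

End CharacteristicP.

Lemma deriv_exp_noncomm (S : nzRingType) (c : {poly S}) n :
  (c ^+ n)^`() = \sum_(j < n) c ^+ (n.-1 - j) * c^`() * c ^+ j.
Proof.
elim: n => [|n IH]; first by rewrite big_ord0 derivC.
rewrite exprSr derivM IH big_ord_recl subn0 expr0 mulr1 addrC; congr (_ + _).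
rewrite mulr_suml; apply: eq_bigr => j _.
by rewrite -mulrA -exprSr /= /bump add1n -subn1 subnAC subn1 -subnS.
Qed.

Lemma subrXX_noncomm (S : nzRingType) (c a : S) n :
  c ^+ n - a ^+ n = \sum_(j < n) c ^+ (n.-1 - j) * (c - a) * a ^+ j.
Proof.
elim: n => [|n IH]; first by rewrite big_ord0 subrr.
rewrite big_ord_recl subn0 expr0 mulr1 !exprSr.
have -> : c ^+ n * c - a ^+ n * a = c ^+ n * (c - a) + (c ^+ n - a ^+ n) * a.
  by rewrite mulrBr mulrBl addrA subrK.
congr (_ + _); rewrite IH mulr_suml; apply: eq_bigr => j _.
by rewrite -mulrA -exprSr /= /bump add1n -subn1 subnAC subn1 -subnS.
Qed.

(** * Sums of words *)

Section WordSums.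

Variables (k : fieldType) (B : algType k) (a x : B).
Local Notation br := (commutator_bracket (A := B) *%R).

Definition linear_poly : {poly B} := x%:P * 'X + a%:P.

(* The sum of the words of length [n] with [r] letters [x] and [n - r] letters
   [a]. *)
Definition word_sum (n r : nat) : B := (linear_poly ^+ n)`_r.

Lemma coef_linear_polyM (q : {poly B}) i :
  (linear_poly * q)`_i = (if i is j.+1 then x * q`_j else 0) + a * q`_i.
Proof.
rewrite mulrDl -mulrA -commr_polyX coefD coefCM coefMX coefCM.
by case: i => [|i]; rewrite ?mulr0.
Qed.

Lemma coef_mul_linear_poly (q : {poly B}) i :
  (q * linear_poly)`_i = (if i is j.+1 then q`_j * x else 0) + q`_i * a.
Proof. by rewrite mulrDr mulrA coefD coefMX !coefMC; case: i. Qed.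

Lemma ad_words_coef n r y :
  ad_words a x n r y =
  (iter n (fun u => linear_poly * u - u * linear_poly) y%:P)`_r.
Proof.
elim: n r => [|n IH] r; first by rewrite /ad_words /= coefC.
rewrite iterS coefB coef_linear_polyM coef_mul_linear_poly -!IH.
rewrite ad_wordsS /commutator_bracket opprD addrACA.
by congr (_ + _); case: r => [|r]; rewrite ?subr0 // IH.
Qed.

Lemma word_sum_small n r : (n < r)%N -> word_sum n r = 0.
Proof.
elim: n r => [|n IH] [|r] ltnr //; first by rewrite /word_sum expr0 coef1.
rewrite /word_sum exprS coef_linear_polyM -!/(word_sum _ _).
by rewrite !IH ?mulr0 ?addr0 // ltnW.
Qed.

Lemma word_sum0 n : word_sum n 0 = a ^+ n.
Proof.
elim: n => [|n IH]; first by rewrite /word_sum !expr0 coef1.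
by rewrite /word_sum exprS coef_linear_polyM -/(word_sum _ _) IH add0r exprS.
Qed.

Lemma word_sumn n : word_sum n n = x ^+ n.
Proof.
elim: n => [|n IH]; first by rewrite /word_sum !expr0 coef1.
rewrite /word_sum exprS coef_linear_polyM -!/(word_sum _ _) IH.
by rewrite word_sum_small // mulr0 addr0 exprS.
Qed.

Lemma horner_linear_poly_exp (l : k) n :
  (linear_poly ^+ n).[l%:A] = (a + l *: x) ^+ n.
Proof.
have central (u : B) : u * l%:A = l%:A * u by rewrite mulr_algl mulr_algr.
rewrite horner_exp_comm; last by rewrite /comm_poly central.
by rewrite hornerD !hornerC hornerMX hornerC mulr_algr addrC.
Qed.

Lemma exprD_word_sum n : (x + a) ^+ n = \sum_(r < n.+1) word_sum n r.
Proof.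
rewrite -[x]scale1r addrC -horner_linear_poly_exp (@horner_coef_wide _ n.+1).
  by apply: eq_bigr => r _; rewrite scale1r expr1n mulr1.
by apply/leq_sizeP => j ltnj; apply: word_sum_small.
Qed.

Lemma sum_exp_word_sum (l : k) n :
  \sum_(j < n) (a + l *: x) ^+ (n.-1 - j) * x * a ^+ j =
  \sum_(r < n) l ^+ r *: word_sum n r.+1.
Proof.
have central (u : B) : u * l%:A = l%:A * u by rewrite mulr_algl mulr_algr.
pose T := \sum_(j < n) linear_poly ^+ (n.-1 - j) * x%:P * a%:P ^+ j.
have T_coef i : T`_i = word_sum n i.+1.
  have : linear_poly ^+ n - a%:P ^+ n = T * 'X.
    rewrite subrXX_noncomm mulr_suml; apply: eq_bigr => j _.
    by rewrite /linear_poly addrK -!mulrA -(commr_polyX (a%:P ^+ j)).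
  move/(congr1 (fun q : {poly B} => q`_i.+1)).
  by rewrite coefB coefMX -polyC_exp coefC /= subr0 => <-.
transitivity T.[l%:A].
  rewrite horner_sum; apply: eq_bigr => j _.
  rewrite -polyC_exp !hornerM_comm ?hornerC ?horner_linear_poly_exp //;
    by rewrite /comm_poly central.
rewrite (@horner_coef_wide _ n); last first.
  by apply/leq_sizeP => j lenj; rewrite T_coef word_sum_small.
apply: eq_bigr => r _; rewrite T_coef.
by rewrite -[l%:A]/(in_alg B l) -rmorphXn /= mulr_algr.
Qed.

(* Jacobson's formula. Differentiating [(t x + a)^p] in [t] gives the sum of the
   [(t x + a)^(p-1-j) x (t x + a)^j], that is [(ad (t x + a))^(p-1) (x)] in
   characteristic [p]. *)
Lemma word_sum_ad_words p r : p \in [pchar k] ->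
  word_sum p r.+1 *+ r.+1 = ad_words a x p.-1 r x.
Proof.
move=> charkp; have charPp : p \in [pchar {poly B}].
  apply: (rmorph_pchar (@polyC B)); exact: (rmorph_pchar (in_alg B)).
rewrite ad_words_coef (iter_commutator_pred_pchar charPp) -coef_deriv.
rewrite deriv_exp_noncomm.
suff -> : linear_poly^`() = x%:P by [].
by rewrite derivD derivM !derivC derivX mul0r add0r mulr1 addr0.
Qed.

Lemma invr_ad_words p r : p \in [pchar k] -> (0 < r < p)%N ->
  (r%:R : k)^-1 *: ad_words a x p.-1 r.-1 x = word_sum p r.
Proof.
case: r => // r charkp /= ltrp.
rewrite -word_sum_ad_words // -scaler_nat scalerA mulVf ?scale1r //.
by rewrite -(dvdn_pcharf charkp) gtnNdvd.
Qed.

Lemma rb_pmap_word_sum p (l : k) : p \in [pchar k] ->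
  rb_pmap p l br (fun z => z ^+ p) (fun=> a) x =
  \sum_(r < p) l ^+ r *: word_sum p r.+1.
Proof.
move=> charkp; have p_gt0 := prime_gt0 (pcharf_prime charkp).
rewrite /rb_pmap -(big_mkord predT (fun r => l ^+ r *: word_sum p r.+1)).
rewrite -[in RHS](prednK p_gt0) big_nat_recr //= prednK // word_sumn addrC.
congr (_ + _); rewrite -[in LHS](prednK p_gt0) big_add1 /=.
apply: eq_big_nat => r ltrp.
rewrite mulrC -scalerA prednK //; congr (_ *: _).
rewrite -(@invr_ad_words p r.+1) //; last by rewrite /= -ltn_predRL.
by rewrite -(composition_ad_words a x r p_gt0).
Qed.

End WordSums.

(** * Rota-Baxter algebras *)

Section Transfer.

Variables (k : fieldType) (V W : lmodType k).
Variables (brV : V -> V -> V) (brW : W -> W -> W) (f : {linear V -> W}).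
Hypothesis f_br : forall x y, f (brV x y) = brW (f x) (f y).

Lemma iter_bracket_morph n x y :
  f (iter n (brV x) y) = iter n (brW (f x)) (f y).
Proof. by elim: n => //= n IH; rewrite f_br IH. Qed.

Lemma jacobson_s_morph p i x y :
  f (jacobson_s p brV i x y) = jacobson_s p brW i (f x) (f y).
Proof.
rewrite linearZ; congr (_ *: _); rewrite /=.
elim: p.-1 {i}i.-1 => [|n IH] i.
  by rewrite /=; case: eqP; rewrite ?linear0.
rewrite !iterS {1 3}/ad_txy linearD f_br IH.
by congr (_ + _); case: i => [|i]; rewrite ?linear0 // f_br IH.
Qed.

Lemma right_nested_bracket_morph s :
  f (right_nested_bracket brV s) = right_nested_bracket brW (map f s).
Proof.
elim: s => [|x [|y s] IH] //=; first exact: linear0.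
by rewrite f_br IH.
Qed.

Lemma rb_pmap_morph p lam (pmV : V -> V) (pmW : W -> W) R x :
  f (pmV x) = pmW (f x) ->
  f (rb_pmap p lam brV pmV R x) =
  rb_pmap p lam brW pmW (fun=> f (R x)) (f x).
Proof.
move=> f_pm; rewrite linearD linearZ /= f_pm linear_sum; congr (_ + _).
apply: eq_bigr => r _; rewrite linearZ /= linear_sum; congr (_ *: _).
apply: eq_bigr => t _; rewrite raddfMn; congr (_ *+ _).
rewrite [LHS]right_nested_bracket_morph.
congr (right_nested_bracket _ _); rewrite -[LHS]map_comp; apply: eq_map => n.
exact: iter_bracket_morph.
Qed.

End Transfer.

Section EmbeddedAlgebra.

Variables (k : fieldType) (p : nat).
Hypothesis charkp : p \in [pchar k].
Variables (A : lmodType k) (mul : A -> A -> A).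
Variables (B : algType k) (f : {linear A -> B}).
Hypothesis f_inj : injective f.
Hypothesis f_mul : forall x y, f (mul x y) = f x * f y.
Local Notation brA := (commutator_bracket mul).
Local Notation brB := (commutator_bracket (A := B) *%R).

Let f_br x y : f (brA x y) = brB (f x) (f y).
Proof. by rewrite linearB !f_mul. Qed.

Let f_pow n x : (0 < n)%N -> f (assoc_pow mul n x) = f x ^+ n.
Proof.
case: n => // n _; rewrite /assoc_pow /=.
by elim: n => [|n IH] /=; rewrite ?expr1 // f_mul IH [RHS]exprS.
Qed.

Let p_gt0 : (0 < p)%N. Proof. exact: prime_gt0 (pcharf_prime charkp). Qed.

Lemma commutator_is_lie_algebra : is_lie_algebra brA.
Proof.
split.
- split=> [y|x] c u v; apply: f_inj;
    rewrite linearP !f_br /commutator_bracket linearP mulrDl mulrDr;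
    by rewrite -scalerAl -scalerAr scalerBr opprD addrACA.
- by move=> x; rewrite /commutator_bracket subrr.
- move=> x y z; apply: f_inj.
  by rewrite 2!linearD linear0 !f_br bracket_jacobi.
Qed.

Lemma commutator_restricted_lie_algebra :
  is_restricted_lie_algebra p brA (assoc_pow mul p).
Proof.
have charBp : p \in [pchar B] := rmorph_pchar (in_alg _) charkp.
split; first exact: commutator_is_lie_algebra.
- move=> c x; apply: f_inj.
  by rewrite [RHS]linearZ !f_pow // linearZ /= exprZn.
- move=> x y; apply: f_inj.
  rewrite f_br (iter_bracket_morph f_br) f_pow //.
  by rewrite [RHS](iter_commutator_pchar charBp).
- move=> x y; apply: f_inj.
  rewrite [RHS]linearD linearD linear_sum !f_pow //.
  rewrite [f (x + y)]linearD exprD_word_sum.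
  rewrite big_ord_recr /= word_sumn -(big_mkord predT (word_sum (f y) (f x) p)).
  rewrite [in LHS]big_ltn // word_sum0 [LHS]addrC addrA; congr (_ + _).
  apply: eq_big_nat => i ltip.
  by rewrite [RHS](jacobson_s_morph f_br) -(invr_ad_words _ _ charkp ltip).
Qed.

Variables (lam : k) (P : A -> A).
Hypothesis hP : is_rb_operator lam mul P.

Definition rb_product (x y : A) : A :=
  mul (P x) y + mul x (P y) + lam *: mul x y.

Lemma rb_product_pow n x :
  P (iter n (rb_product x) x) = iter n (mul (P x)) (P x).
Proof.
have PD u v : P (u + v) = P u + P v by have := hP.1 1 u v; rewrite !scale1r.
have P0 : P 0 = 0 by apply: (addrI (P 0)); rewrite -PD !addr0.
have PZ c u : P (c *: u) = c *: P u by have := hP.1 c u 0; rewrite P0 !addr0.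
by elim: n => //= n <-; rewrite hP.2 !PD PZ.
Qed.

Lemma morph_rb_product_pow n x :
  f (iter n (rb_product x) x) =
  \sum_(j < n.+1) (f (P x) + lam *: f x) ^+ (n - j) * f x * f (P x) ^+ j.
Proof.
elim: n => [|n IH].
  by rewrite big_ord_recl big_ord0 /= !expr0 mul1r mulr1 addr0.
rewrite iterS /rb_product {1}rb_product_pow.
rewrite !linearD linearZ /= !f_mul IH.
have -> : f (iter n (mul (P x)) (P x)) = f (P x) ^+ n.+1 by rewrite -f_pow.
rewrite addrAC scalerAl -mulrDl [RHS]big_ord_recr /= subnn expr0 mul1r.
congr (_ + _).
rewrite mulr_sumr; apply: eq_bigr => j _.
by rewrite subSn ?exprS ?mulrA // -ltnS.
Qed.

Lemma rb_pmap_rb_product_pow x :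
  rb_pmap p lam brA (assoc_pow mul p) P x = iter p.-1 (rb_product x) x.
Proof.
apply: f_inj.
rewrite (@rb_pmap_morph _ _ _ _ brB f f_br _ _ _ (fun z => z ^+ p)) ?f_pow //.
rewrite rb_pmap_word_sum // -sum_exp_word_sum morph_rb_product_pow.
by rewrite prednK.
Qed.

Lemma commutator_rb_operator : is_rb_operator lam brA P.
Proof.
have PD u v : P (u + v) = P u + P v by have := hP.1 1 u v; rewrite !scale1r.
have PN u : P (- u) = - P u.
  have P0 : P 0 = 0 by apply: (addrI (P 0)); rewrite -PD !addr0.
  by apply/eqP; rewrite -addr_eq0 -PD addNr P0.
split=> [|x y]; first exact: hP.1.
rewrite /commutator_bracket !hP.2 !PD !PN scalerBr.
rewrite [P (mul (P y) x) + _]addrC opprD [LHS]addrACA opprD.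
by congr (_ + _); rewrite addrACA.
Qed.

Lemma rb_algebra_restricted :
  is_restricted_rb_lie_algebra p lam brA (assoc_pow mul p) P.
Proof.
split; first exact: commutator_restricted_lie_algebra.
  exact: commutator_rb_operator.
by move=> x; rewrite rb_pmap_rb_product_pow rb_product_pow.
Qed.

End EmbeddedAlgebra.

Theorem corollary4p14 (k : closedFieldType) (p : nat)
    (charkp : p \in [pchar k]%R) (lam : k)
    (g : lmodType k) (br : g -> g -> g) (R : g -> g)
    (hg : is_rb_lie_algebra lam br R)
    (unital : bool)
    (U : lmodType k) (mul : U -> U -> U) (P : U -> U) (iota : g -> U)
    (hU : is_universal_enveloping_rb_algebra unital lam br R mul P iota) :
  is_restricted_rb_lie_algebra p lam
    (commutator_bracket mul) (assoc_pow mul p) P.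
Proof.
have [hA hP] := universal_enveloping_rb hU.
exact: (rb_algebra_restricted charkp (@unitization_in_inj _ _ _ hA)
  (@unitization_inM _ _ _ hA)).
Qed.
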